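(* Let $n\ge1$, let $x\in S^{(n)}$ be a signal that is not constant, let $\mu=x(-\infty+0)$ be its initial value, and let $T>0$, $t'\in\mathbf{R}$ be such that $$(-\infty,t']\subset\mathbf{T}_{x(-\infty+0)}^x$$ and $$\forall t\in\mathbf{T}_\mu^x\cap[t',\infty),\ \{t+zT\mid z\in\mathbf{Z}\}\cap[t',\infty)\subset\mathbf{T}_\mu^x .$$ Define $t_0,t_1\in\mathbf{R}$ by the requirements $$\forall t<t_0,\ x(t)=\mu,\qquad x(t_0)\ne\mu,$$ $$t_1<t_0+T,\qquad \forall t\in[t_1,t_0+T),\ x(t)=x(t_0+T-0),\qquad x(t_1-0)\ne x(t_1).$$ Then $$t_1-T\le t'<t_0<t_1$$ and $$(-\infty,t_0)\cup[t_1,t_0+T)\cup[t_1+T,t_0+2T)\cup[t_1+2T,t_0+3T)\cup\dots\subset\mathbf{T}_\mu^x ,$$ that is, $(-\infty,t_0)\cup\bigcup_{k\ge0}[t_1+kT,\,t_0+(k+1)T)\subset\mathbf{T}_\mu^x$.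
   Context: $\mathbf{B}=\{0,1\}$ is the two-element field with addition $\oplus$ (modulo 2 sum) and the usual product, and $\mathbf{B}^n$ ($n\ge1$) is the induced linear space. For $A\subset\mathbf{R}$, $\chi_A:\mathbf{R}\to\mathbf{B}$ is the characteristic function of $A$. A (continuous time) signal is a function $x:\mathbf{R}\to\mathbf{B}^n$ of the form $$x(t)=\mu\cdot\chi_{(-\infty,s_0)}(t)\oplus x(s_0)\cdot\chi_{[s_0,s_1)}(t)\oplus\dots\oplus x(s_k)\cdot\chi_{[s_k,s_{k+1})}(t)\oplus\dots\quad\text{for all }t\in\mathbf{R},$$ where $\mu\in\mathbf{B}^n$ and $(s_k)_{k\in\mathbf{N}}$ is a strictly increasing real sequence that is unbounded from above. The set of such functions is denoted $S^{(n)}$. The vector $\mu$ (the constant value of $x$ on $(-\infty,s_0)$) is called the initial value of $x$ and is denoted $x(-\infty+0)$. The left limit of such an $x$ is the function $$x(t-0)=\mu\cdot\chi_{(-\infty,s_0]}(t)\oplus x(s_0)\cdot\chi_{(s_0,s_1]}(t)\oplus\dots\oplus x(s_k)\cdot\chi_{(s_k,s_{k+1}]}(t)\oplus\dots,$$ which does not depend on the choice of $(s_k)$; for every $t\in\mathbf{R}$ there is $\varepsilon>0$ with $x(\xi)=x(t-0)$ for all $\xi\in(t-\varepsilon,t)$. In particular $x(t_0+T-0)$ is the left limit of $x$ at the point $t_0+T$. The orbit of $x$ is $Or(x)=\{x(t)\mid t\in\mathbf{R}\}$, and for $\mu\in Or(x)$ we put $\mathbf{T}_\mu^x=\{t\in\mathbf{R}\mid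 x(t)=\mu\}$. *)

(* Defs.v *)
From HB Require Import structures.
From mathcomp Require Export all_boot all_order all_algebra.
From mathcomp Require Export all_classical all_reals all_analysis.

Set Implicit Arguments.
Unset Strict Implicit.
Unset Printing Implicit Defensive.

Import Order.TTheory GRing.Theory Num.Theory.
Import numFieldNormedType.Exports.

Local Open Scope classical_set_scope.
Local Open Scope ring_scope.

(* The two-element field B is 'F_2 and B^n is 'rV['F_2]_n, so that +, *: and
   \1_A stand for the modulo 2 sum, the product by a scalar and chi_A. *)

(* At each t at most one term of the sum is nonzero, hence the finitely
   supported sum is the infinite modulo 2 sum. *)
Definition signal_repr (R : realType) (n : nat) (x : R -> 'rV['F_2]_n)
    (mu : 'rV['F_2]_n) (s : nat -> R) : Prop :=
  [/\ increasing_seq s, ~ has_ubound (range s) &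
      forall t : R,
        x t = \1_(`]-oo, s 0%N[) t *: mu
              + \sum_(k \in [set: nat]) \1_(`[s k, s k.+1[) t *: x (s k)].

Definition signal (R : realType) (n : nat) : set (R -> 'rV['F_2]_n) :=
  [set x | exists mu s, signal_repr x mu s].

(* x(-oo + 0); the value 0 is only used when x is not a signal, see
   [initial_valueE] for the independence of the representation *)
Definition initial_value (R : realType) (n : nat)
    (x : R -> 'rV['F_2]_n) : 'rV['F_2]_n :=
  xget 0 [set mu | exists s, signal_repr x mu s].

Definition left_limit_repr (R : realType) (n : nat) (x : R -> 'rV['F_2]_n)
    (mu : 'rV['F_2]_n) (s : nat -> R) : R -> 'rV['F_2]_n :=
  fun t => \1_(`]-oo, s 0%N]) t *: mu
           + \sum_(k \in [set: nat]) \1_(`]s k, s k.+1]) t *: x (s k).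

(* [left_limit x t] is x(t - 0); the default is only used when x is not a
   signal, see [left_limitE] for the independence of the representation *)
Definition left_limit (R : realType) (n : nat)
    (x : R -> 'rV['F_2]_n) : R -> 'rV['F_2]_n :=
  xget (fun=> 0) [set y | exists mu s,
    signal_repr x mu s /\ y = left_limit_repr x mu s].

(* T_mu^x *)
Definition support_set (R : realType) (n : nat) (x : R -> 'rV['F_2]_n)
    (mu : 'rV['F_2]_n) : set R :=
  [set t | x t = mu].

Lemma signal_repr_before (R : realType) (n : nat) (x : R -> 'rV['F_2]_n)
    (mu : 'rV['F_2]_n) (s : nat -> R) (t : R) :
  signal_repr x mu s -> t < s 0%N -> x t = mu.
Proof.
move=> [si _ ->] ts0; rewrite fsbig1 => [|k _].
  by rewrite indicE mem_set ?scale1r ?addr0 //= in_itv.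
rewrite indicE memNset ?scale0r //= in_itv /= => /andP[skt _].
by have := lt_le_trans ts0 (le_trans (_ : s 0%N <= s k) skt);
  rewrite ltxx => H; have := H; rewrite si leq0n => /(_ isT).
Qed.

Lemma seq_cell (R : realType) (s : nat -> R) (t : R) :
  increasing_seq s -> ~ has_ubound (range s) -> s 0%N < t ->
  exists k, s k < t <= s k.+1.
Proof.
move=> si su s0t.
have ex : exists m, t <= s m.
  apply: contrapT => H; apply: su; exists t => _ [m _ <-].
  by rewrite leNgt; apply/negP => tm; apply: H; exists m; exact: ltW.
case: (ex_minnP ex) => -[|k] tk kmin; first by have := lt_le_trans s0t tk;
  rewrite ltxx.
exists k; rewrite tk andbT ltNge; apply/negP => /kmin.
by rewrite ltnn.
Qed.

Lemma left_limit_repr_before (R : realType) (n : nat) (x : R -> 'rV['F_2]_n)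
    (mu : 'rV['F_2]_n) (s : nat -> R) (t : R) :
  increasing_seq s -> t <= s 0%N -> left_limit_repr x mu s t = mu.
Proof.
move=> si ts0; rewrite /left_limit_repr fsbig1 => [|k _].
  by rewrite indicE mem_set ?scale1r ?addr0 //= in_itv.
rewrite indicE memNset ?scale0r //= in_itv /= => /andP[skt _].
have sk : s 0%N <= s k by rewrite si.
by have := le_lt_trans sk (lt_le_trans skt ts0); rewrite ltxx.
Qed.

Lemma signal_repr_cell (R : realType) (n : nat) (x : R -> 'rV['F_2]_n)
    (mu : 'rV['F_2]_n) (s : nat -> R) (k : nat) (t : R) :
  signal_repr x mu s -> s k <= t < s k.+1 -> x t = x (s k).
Proof.
move=> [si _ xE] /andP[skt tsk]; rewrite (xE t).
have s0k : s 0%N <= s k by rewrite si.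
rewrite indicE memNset ?scale0r ?add0r /=; last first.
  rewrite in_itv /= => ts0.
  by have := le_lt_trans (le_trans s0k skt) ts0; rewrite ltxx.
rewrite -(@fsbig_widen _ _ _ _ [set k]) //=; last first.
  move=> j [_ /= jk]; rewrite indicE memNset ?scale0r //= in_itv /=.
  move=> /andP[sjt tsj]; apply: jk; apply/eqP; rewrite eqn_leq.
  have := le_lt_trans sjt tsk; have := le_lt_trans skt tsj.
  by rewrite !ltNge !si -!ltnNge !ltnS => -> ->.
by rewrite fsbig_set1 indicE mem_set ?scale1r //= in_itv /= skt.
Qed.

Lemma left_limit_repr_cell (R : realType) (n : nat) (x : R -> 'rV['F_2]_n)
    (mu : 'rV['F_2]_n) (s : nat -> R) (k : nat) (t : R) :
  increasing_seq s -> s k < t <= s k.+1 -> left_limit_repr x mu s t = x (s k).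
Proof.
move=> si /andP[skt tsk]; rewrite /left_limit_repr.
have s0k : s 0%N <= s k by rewrite si.
rewrite indicE memNset ?scale0r ?add0r /=; last first.
  rewrite in_itv /= => ts0.
  by have := lt_le_trans (le_lt_trans s0k skt) ts0; rewrite ltxx.
rewrite -(@fsbig_widen _ _ _ _ [set k]) //=; last first.
  move=> j [_ /= jk]; rewrite indicE memNset ?scale0r //= in_itv /=.
  move=> /andP[sjt tsj]; apply: jk; apply/eqP; rewrite eqn_leq.
  have := lt_le_trans sjt tsk; have := lt_le_trans skt tsj.
  by rewrite !ltNge !si -!ltnNge !ltnS => -> ->.
by rewrite fsbig_set1 indicE mem_set ?scale1r //= in_itv /= skt.
Qed.

Lemma left_limit_reprP (R : realType) (n : nat) (x : R -> 'rV['F_2]_n)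
    (mu : 'rV['F_2]_n) (s : nat -> R) (t : R) :
  signal_repr x mu s ->
  exists2 e : R, 0 < e &
    forall u, t - e < u < t -> x u = left_limit_repr x mu s t.
Proof.
move=> xs; have [si su _] := xs.
have [ts0|s0t] := leP t (s 0%N).
  exists 1 => // u /andP[_ ut].
  rewrite left_limit_repr_before // (signal_repr_before xs) //.
  exact: lt_le_trans ut ts0.
have [k /andP[skt tsk]] := seq_cell si su s0t.
exists (t - s k); first by rewrite subr_gt0.
move=> u; rewrite subKr => /andP[sku ut].
rewrite (@left_limit_repr_cell _ _ x mu s k) ?skt //.
by rewrite (signal_repr_cell xs (k := k)) // ltW //= (lt_le_trans ut tsk).
Qed.

Lemma initial_valueE (R : realType) (n : nat) (x : R -> 'rV['F_2]_n)
    (mu : 'rV['F_2]_n) (s : nat -> R) :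
  signal_repr x mu s -> initial_value x = mu.
Proof.
move=> xs; apply: xget_subset1; first by exists s.
move=> a b [sa xa] [sb xb].
pose t := Num.min (sa 0%N) (sb 0%N) - 1.
have tm : t < Num.min (sa 0%N) (sb 0%N) by rewrite gtrBl.
move: tm; rewrite lt_min => /andP[ta tb].
by rewrite -(signal_repr_before xa ta) (signal_repr_before xb tb).
Qed.

Lemma left_limitE (R : realType) (n : nat) (x : R -> 'rV['F_2]_n)
    (mu : 'rV['F_2]_n) (s : nat -> R) :
  signal_repr x mu s -> left_limit x = left_limit_repr x mu s.
Proof.
move=> xs; apply: xget_subset1; first by exists mu, s.
move=> a b [ma [sa [xa ->]]] [mb [sb [xb ->]]]; apply/funext => t.
have [ea ea0 Ha] := left_limit_reprP t xa.
have [eb eb0 Hb] := left_limit_reprP t xb.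
have e0 : 0 < Num.min ea eb / 2 by rewrite divr_gt0 // lt_min ea0.
have e1 : Num.min ea eb / 2 < Num.min ea eb.
  by rewrite ltr_pdivrMr // ltr_pMr ?ltr1n // lt_min ea0.
move: (e1); rewrite lt_min => /andP[e1a e1b].
rewrite -(Ha (t - Num.min ea eb / 2)) -?(Hb (t - Num.min ea eb / 2)) //.
  by rewrite ltrD2l ltrN2 e1b gtrBl.
by rewrite ltrD2l ltrN2 e1a gtrBl.
Qed.

Lemma left_limitP (R : realType) (n : nat) (x : R -> 'rV['F_2]_n) (t : R) :
  signal x ->
  exists2 e : R, 0 < e & forall u, t - e < u < t -> x u = left_limit x t.
Proof.
by move=> [mu [s xs]]; rewrite (left_limitE xs); exact: left_limit_reprP.
Qed.

Lemma signal_cell (R : realType) (s : nat -> R) (t : R) :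
  increasing_seq s -> ~ has_ubound (range s) -> s 0%N <= t ->
  exists k, s k <= t < s k.+1.
Proof.
move=> si su; have sS k : s k < s k.+1 by rewrite ltNge si ltnn.
rewrite le_eqVlt => /predU1P[<-|s0t]; first by exists 0%N; rewrite lexx sS.
have [k /andP[skt]] := seq_cell si su s0t.
rewrite le_eqVlt => /predU1P[->|tsk]; last by exists k; rewrite ltW.
by exists k.+1; rewrite lexx sS.
Qed.

(* The two lemmas below show that the switching times t0 and t1 are well
   defined. *)
Lemma first_switch (R : realType) (n : nat) (x : R -> 'rV['F_2]_n) :
  signal x -> ~ (exists c, forall t, x t = c) ->
  exists! t0 : R,
    (forall t, t < t0 -> x t = initial_value x) /\ x t0 <> initial_value x.
Proof.
move=> [mu [s xs]] xnc; have [si su _] := xs; rewrite (initial_valueE xs).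
have ex : exists k, x (s k) != mu.
  apply: contrapT => H; apply: xnc; exists mu => t.
  have [s0t|ts0] := leP (s 0%N) t; last exact: signal_repr_before xs ts0.
  have [k kt] := signal_cell si su s0t.
  rewrite (signal_repr_cell xs kt); apply/eqP/negPn/negP => xk.
  by apply: H; exists k.
case: (ex_minnP ex) => k /eqP xk kmin; exists (s k); split.
  split=> // t tsk; have [s0t|ts0] := leP (s 0%N) t; last first.
    exact: signal_repr_before xs ts0.
  have [j jt] := signal_cell si su s0t.
  rewrite (signal_repr_cell xs jt); apply/eqP/negPn/negP => /kmin kj.
  have /andP[sjt _] := jt; have := le_lt_trans sjt tsk.
  by rewrite ltNge si kj.
move=> t [tl tn]; apply/eqP; rewrite eq_le !leNgt.
apply/andP; split; apply/negP => lt; last exact: (xk (tl _ lt)).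
apply: tn; have [s0t|ts0] := leP (s 0%N) t; last first.
  exact: signal_repr_before xs ts0.
have [j jt] := signal_cell si su s0t.
rewrite (signal_repr_cell xs jt); apply/eqP/negPn/negP => /kmin kj.
have /andP[sjt _] := jt; have := le_lt_trans sjt lt.
by rewrite ltNge si kj.
Qed.

Lemma last_switch (R : realType) (n : nat) (x : R -> 'rV['F_2]_n) (a b : R) :
  signal x -> a < b -> left_limit x a <> x a ->
  exists! t1 : R, [/\ t1 < b,
    forall t, t \in `[t1, b[ -> x t = left_limit x b &
    left_limit x t1 <> x t1].
Proof.
move=> sx ab xa; have [mu [s xs]] := sx; have [si su _] := xs.
have uniq t u : t < u -> u < b ->
    (forall v, v \in `[t, b[ -> x v = left_limit x b) ->
    left_limit x u = x u.
  move=> tu ub xt; have [e e0 He] := left_limitP u sx.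
  have [v /andP[v1 v2]] : exists v, Num.max t (u - e) < v < u.
    exists ((Num.max t (u - e) + u) / 2); rewrite midf_lt ?midf_lt //.
      by rewrite gt_max tu gtrBl.
    by rewrite gt_max tu gtrBl.
  move: v1; rewrite gt_max => /andP[tv uv].
  rewrite -(He v) ?uv // !xt // in_itv /=; first by rewrite (ltW tu).
  by rewrite (ltW tv) (lt_trans v2 ub).
have s0a : s 0%N <= a.
  rewrite leNgt; apply/negP => as0; apply: xa.
  by rewrite (left_limitE xs) (left_limit_repr_before _ _ si (ltW as0))
    (signal_repr_before xs as0).
have [j0 j0a] := signal_cell si su s0a.
have aE : a = s j0.
  have /andP[ja aj] := j0a; move: ja; rewrite le_eqVlt => /predU1P[//|ja].
  exfalso; apply: xa; rewrite (left_limitE xs) (signal_repr_cell xs j0a).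
  by apply: left_limit_repr_cell; rewrite ?ja ?ltW.
have [k kb] := seq_cell si su (le_lt_trans s0a ab).
have /andP[skb bsk] := kb.
have j0k : (j0 <= k)%N.
  by rewrite -ltnS ltnNge -si -ltNge -aE (lt_le_trans ab bsk).
have ex : exists j, (j <= k)%N && (left_limit x (s j) != x (s j)).
  by exists j0; rewrite j0k /= -aE; apply/eqP.
have ub j : (j <= k)%N && (left_limit x (s j) != x (s j)) -> (j <= k)%N.
  by case/andP.
case: (ex_maxnP ex ub) => j /andP[jk /eqP xj] jmax.
have cst d : (j + d <= k)%N -> x (s (j + d)%N) = x (s j).
  elim: d => [|d IH]; rewrite ?addn0 // addnS => jdk.
  rewrite -(IH (ltnW jdk)).
  have sS : s (j + d)%N < s (j + d).+1 by rewrite ltNge si ltnn.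
  have -> : x (s (j + d)%N) = left_limit x (s (j + d).+1).
    by rewrite (left_limitE xs) (left_limit_repr_cell _ _ (k := (j + d)%N)) ?sS
      ?lexx.
  apply/eqP; rewrite eq_sym; apply/negPn/negP => H.
  by have := jmax (j + d).+1; rewrite jdk H => /(_ isT);
    rewrite -addnS -[X in (_ <= X)%N]addn0 leq_add2l.
have sjk : s j <= s k by rewrite si.
have P1 : s j < b by exact: le_lt_trans sjk skb.
have P2 t : t \in `[s j, b[ -> x t = left_limit x b.
  rewrite in_itv /= => /andP[sjt tb].
  have s0t : s 0%N <= t by apply: le_trans sjt; rewrite si.
  have [i it] := signal_cell si su s0t; have /andP[i1 i2] := it.
  rewrite (signal_repr_cell xs it) (left_limitE xs).
  rewrite (left_limit_repr_cell _ _ si kb).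
  have ji : (j <= i)%N by rewrite -ltnS ltnNge -si -ltNge (le_lt_trans sjt i2).
  have ik : (i <= k)%N.
    rewrite -ltnS ltnNge -si -ltNge (le_lt_trans i1) //.
    exact: lt_le_trans tb bsk.
  by rewrite -(subnKC ji) -(subnKC jk) !cst ?subnKC.
exists (s j); split=> // t [tb xt tn].
apply/eqP; rewrite eq_le !leNgt; apply/andP; split; apply/negP => lt.
  by apply: xj; exact: uniq lt P1 xt.
by apply: tn; exact: uniq lt tb P2.
Qed.

(* Main.v *)
Require Import Defs.
Import Order.TTheory GRing.Theory Num.Theory.
Import numFieldNormedType.Exports.
Local Open Scope classical_set_scope.
Local Open Scope ring_scope.

(** Write S for the set where x equals its initial value mu. Above t', the
    hypothesis makes S stable under translation by multiples of T.

    Since x = mu on [t', t0[, translating by T gives x = mu on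
    [t' + T, t0 + T[. Hence the left limit of x at t0 + T is mu, so that x is
    constantly mu on the whole of [t1, t0 + T[, and in particular at t1. The
    condition left_limit x t1 <> x t1 now says that x is not constantly mu just
    before t1, which locates t1 from both sides: t1 cannot lie in
    ]t' + T, t0 + T[, where x is already mu on the left, nor in ]-oo, t0[, where
    x is mu by the choice of t0; and t1 <> t0 because x t0 <> mu.

    Finally [t1, t0 + T[ lies in S and beyond t', so each of its translates
    by k T with k >= 0 lies in S too. *)

(** Being the value of x immediately before t, the left limit is detected on any
    nonempty interval ending at t. *)
Lemma left_limit_cst (R : realType) (n : nat) (x : R -> 'rV['F_2]_n)
    (c : 'rV['F_2]_n) (a t : R) :
  signal x -> a < t -> (forall u, a <= u < t -> x u = c) ->
  left_limit x t = c.
Proof.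
move=> sx at_ xc; have [e e0 xe] := left_limitP t sx.
have mt : Num.max a (t - e) < t by rewrite gt_max at_ gtrBl.
have := midf_lt mt; set u := (_ / _) => -[mu ut].
move: mu; rewrite gt_max => /andP[au teu].
by rewrite -(xe u) ?teu // xc // (ltW au).
Qed.

Theorem theorem11 (R : realType) (n : nat) (hn : (1 <= n)%N)
    (x : R -> 'rV['F_2]_n) (hx : signal x)
    (hnc : ~ exists c : 'rV['F_2]_n, forall t : R, x t = c)
    (mu : 'rV['F_2]_n) (hmu : mu = initial_value x)
    (T t' : R) (hT : 0 < T)
    (ht' : `]-oo, t'] `<=` support_set x (initial_value x))
    (hper : forall t : R, (support_set x mu `&` `[t', +oo[) t ->
       [set t + z%:~R * T | z in [set: int]] `&` `[t', +oo[
         `<=` support_set x mu)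
    (t0 t1 : R)
    (ht0 : forall t : R, t < t0 -> x t = mu)
    (hxt0 : x t0 <> mu)
    (ht1 : t1 < t0 + T)
    (hxt1 : forall t : R, t \in `[t1, t0 + T[ -> x t = left_limit x (t0 + T))
    (hlt1 : left_limit x t1 <> x t1) :
  [/\ t1 - T <= t', t' < t0, t0 < t1 &
      `]-oo, t0[
        `|` \bigcup_(k in [set: nat]) [set` `[t1 + k%:R * T, t0 + k.+1%:R * T[]
        `<=` support_set x mu].
Proof.
rewrite -hmu in ht'.
have t't0 : t' < t0.
  by rewrite ltNge; apply/negP => t0t'; apply/hxt0/ht'; rewrite /= in_itv.
have shift t (k : nat) : t' <= t -> x t = mu -> x (t + k%:R * T) = mu.
  move=> t't xt; apply: (hper t).
    by split=> //=; rewrite in_itv /= t't.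
  split; first by exists k%:Z.
  by rewrite /= in_itv /= andbT ler_wpDr // mulr_ge0 // ltW.
have before_end t : t' + T <= t < t0 + T -> x t = mu.
  move=> /andP[tl tr]; rewrite -(subrK T t) -[X in _ + X]mul1r.
  by apply: (shift _ 1%N); [rewrite lerBrDr|apply: ht0; rewrite ltrBlDr].
have endE : left_limit x (t0 + T) = mu.
  by apply: left_limit_cst before_end => //; rewrite ltrD2r.
have last_cell t : t1 <= t < t0 + T -> x t = mu.
  by move=> tt; rewrite hxt1 ?endE // in_itv.
have xt1 : x t1 = mu by rewrite last_cell // lexx.
have not_left a : a < t1 -> ~ (forall u, a <= u < t1 -> x u = mu).
  by move=> at1 xa; apply: hlt1; rewrite xt1; exact: left_limit_cst at1 xa.
have t0t1 : t0 < t1.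
  rewrite ltNge le_eqVlt; apply/negP => /predU1P[t10|t1t0].
    by apply: hxt0; rewrite -t10.
  apply: (not_left (t1 - 1)) => [|u /andP[_ ut1]]; first by rewrite gtrBl.
  exact/ht0/(lt_trans ut1).
split=> //.
  rewrite lerBlDr leNgt; apply/negP => /not_left; apply=> u /andP[ul ur].
  by rewrite before_end // ul (lt_trans ur).
move=> t [|[k _]] /=; rewrite in_itv /=; first exact: ht0.
rewrite -natr1 mulrDl mul1r addrCA => /andP[tl tr].
have /andP[sl sr] : t1 <= t - k%:R * T < t0 + T.
  by rewrite lerBrDr tl ltrBlDr addrC.
rewrite /support_set /= -(subrK (k%:R * T) t) shift ?last_cell ?sl //.
exact: ltW (lt_le_trans (lt_trans t't0 t0t1) sl).
Qed.
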